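(* For every $C>0$ there exists some $P\subseteq\mathbb{Z}$ with $|P|=4$ such that $\mathsf{pdd}_P(\alpha)<\alpha^C$ for all sufficiently small $\alpha>0$.
   Context: Let $[N]=\{1,\dots,N\}$. For a finite $P\subseteq\mathbb{Z}^r$ and $0<\alpha<1$, the popular difference density $\mathsf{pdd}_P(\alpha)$ is the largest real number such that for every $\epsilon>0$ there exists $N_0=N_0(P,\epsilon)$ such that for every $N\ge N_0$ and every $A\subseteq[N]^r$ with $|A|\ge\alpha N^r$ there is some nonzero integer $d$ with $|\{x\in\mathbb{Z}^r : x+dy\in A \text{ for all } y\in P\}|\ge(\mathsf{pdd}_P(\alpha)-\epsilon)N^r$. *)

(* Defs.v *)
From HB Require Import structures.
From mathcomp Require Import all_boot all_order all_algebra finmap.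
From mathcomp Require Import boolp classical_sets cardinality reals exp.
From mathcomp Require Import lra.

Set Implicit Arguments.
Unset Strict Implicit.
Unset Printing Implicit Defensive.

Import Order.TTheory GRing.Theory Num.Theory.
Local Open Scope classical_set_scope.
Local Open Scope ring_scope.

(* [N]^r, with coordinates 1, ..., N. *)
Definition in_box (r N : nat) (x : 'rV[int]_r) : Prop :=
  forall i, 1 <= x 0 i <= N%:Z.

Definition pattern_set (r : nat) (P A : {fset 'rV[int]_r}) (d : int) :
    set 'rV[int]_r :=
  [set x | forall y, y \in P -> x + d *: y \in A].

(* [fset_set] is the empty set on infinite arguments; [pattern_set P A d] is
   finite as soon as P is nonempty, see [finite_pattern_set]. *)
Definition pattern_count (r : nat) (P A : {fset 'rV[int]_r}) (d : int) : nat :=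
  #|` fset_set (pattern_set P A d)|%fset.

Definition pdd_admissible (R : realType) (r : nat) (P : {fset 'rV[int]_r})
    (alpha c : R) : Prop :=
  forall eps : R, 0 < eps ->
  exists N0 : nat, forall N : nat, (N0 <= N)%N ->
  forall A : {fset 'rV[int]_r}, (forall x, x \in A -> in_box N x) ->
    alpha * N%:R ^+ r <= #|` A|%fset%:R ->
  exists2 d : int, d != 0 &
    (c - eps) * N%:R ^+ r <= (pattern_count P A d)%:R.

(* The supremum is a maximum for P nonempty and alpha <= 1, see [pdd_max]. *)
Definition pdd (R : realType) (r : nat) (P : {fset 'rV[int]_r}) (alpha : R) : R :=
  sup [set c : R | pdd_admissible P alpha c].

Section pdd_facts.
Variables (R : realType) (r : nat) (P : {fset 'rV[int]_r}).
Hypothesis P_neq0 : P != fset0.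

Lemma pattern_set_sub (A : {fset 'rV[int]_r}) (d : int) :
  exists y, pattern_set P A d `<=` [set` [fset x - d *: y | x in A]%fset].
Proof.
case/fset0Pn: P_neq0 => y yP; exists y => x /(_ y yP) xA /=.
by apply/imfsetP; exists (x + d *: y) => //=; rewrite addrK.
Qed.

Lemma finite_pattern_set (A : {fset 'rV[int]_r}) (d : int) :
  finite_set (pattern_set P A d).
Proof.
have [y sub] := pattern_set_sub A d.
exact: sub_finite_set sub (finite_fset _).
Qed.

Lemma pattern_count_le (A : {fset 'rV[int]_r}) (d : int) :
  (pattern_count P A d <= #|` A|)%N.
Proof.
have [y sub] := pattern_set_sub A d.
have <- : #|` [fset x - d *: y | x in A]|%fset = #|` A|%fset.
  by rewrite card_imfset //; exact: addIr.
apply: fsubset_leq_card; apply/fsubsetP => x.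
by rewrite in_fset_set ?inE; [move/sub | exact: finite_pattern_set].
Qed.

Lemma full_box (N : nat) : exists2 A : {fset 'rV[int]_r},
  (forall x, x \in A -> in_box N x) & #|` A| = (N ^ r)%N.
Proof.
pose g (f : {ffun 'I_r -> 'I_N}) : 'rV[int]_r := \row_i (f i).+1%:Z.
exists [fset g f | f in {: {ffun 'I_r -> 'I_N}}]%fset.
  move=> x /imfsetP[/= f _ ->] i; rewrite mxE.
  by rewrite !lez_nat ltn_ord.
rewrite card_imfset /=; last first.
  move=> f1 f2 /rowP e; apply/ffunP => i; apply/val_inj.
  by have := e i; rewrite !mxE => -[].
by rewrite -cardE card_ffun !card_ord.
Qed.

Lemma pdd_admissible0 (alpha : R) : pdd_admissible P alpha 0.
Proof.
move=> e e0; exists 0%N => N _ A _ _; exists 1 => //.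
apply: le_trans (ler0n _ _); rewrite sub0r mulNr oppr_le0.
by rewrite mulr_ge0 ?exprn_ge0 ?ler0n // ltW.
Qed.

Lemma pdd_admissible_le1 (alpha c : R) :
  alpha <= 1 -> pdd_admissible P alpha c -> c <= 1.
Proof.
move=> a1 cP; rewrite leNgt; apply/negP => c1.
have [|N0 /(_ N0.+1 (leqnSn _))] := cP ((c - 1) / 2).
  by rewrite divr_gt0 // subr_gt0.
have [A Abox Acard] := full_box N0.+1; move=> /(_ A Abox).
have Npos : 0 < N0.+1%:R ^+ r :> R by rewrite exprn_gt0 // ltr0n.
rewrite Acard natrX => -[|d _ le_c]; first by rewrite ler_piMl // ltW.
have : (pattern_count P A d)%:R <= N0.+1%:R ^+ r :> R.
  by rewrite -natrX ler_nat -Acard pattern_count_le.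
move/(le_trans le_c); rewrite ger_pMl //; lra.
Qed.

Lemma pdd_max (alpha : R) : alpha <= 1 ->
  pdd_admissible P alpha (pdd P alpha) /\
  (forall c, pdd_admissible P alpha c -> c <= pdd P alpha).
Proof.
move=> a1; set S := [set c : R | pdd_admissible P alpha c].
have supS : has_sup S.
  split; first by exists 0; exact: pdd_admissible0.
  by exists 1 => c; exact: pdd_admissible_le1.
split; last by move=> c cS; apply: sup_upper_bound.
move=> e e0; have e20 : 0 < e / 2 by rewrite divr_gt0.
have [c cS c_gt] := sup_adherent e20 supS.
have [N0 HN0] := cS _ e20; exists N0 => N leN A Abox Acard.
have [d d0 le_c] := HN0 N leN A Abox Acard; exists d => //.
apply: le_trans le_c; apply: ler_wpM2r; first by rewrite exprn_ge0 ?ler0n.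
rewrite /pdd -/S; lra.
Qed.

End pdd_facts.

(* Main.v *)
(* Put [B = L ^ 2] and let [z0, z1, z2, z3] be the squares of [x + d * y] for [y] in
   [(B + 1) ^ 2, 4 * B + 2 * L * (B - 1), 4 * B - 2 * L * (B - 1), 0].  Then
   [8 * B * z0 + 2 * (B - 1) ^ 2 * z3 = (B + 1) ^ 2 * (z1 + z2)].  For integers
   with base [B] digits below [B / 13] nothing carries, so this is an identity
   between digit polynomials; on the unit circle it presents [z0] as a convex
   combination of the others, so Behrend's sphere argument yields a set [S] of
   about [(B / 13) ^ J] integers below [B ^ J] with only trivial solutions.
   Let [A] be the set of [x] modulo a prime [p] for which [x ^ 2 + v] lies in one
   of the short intervals of length [w ~ p / B ^ J] indexed by [S]; a suitable [v]
   makes [A] of density about [13 ^ - J].  In a pattern inside [A] all four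
   squares lie in the same interval, so an injective affine function of [x] is
   confined to [2 * w] values: every [d] has [O (p / B ^ J)] patterns, and [B]
   is at our disposal. *)
Require Import Defs.
From mathcomp Require Import all_boot all_order all_algebra finmap.
From mathcomp Require Import boolp classical_sets cardinality reals exp.
From mathcomp Require Import zify ring lra.

Set Implicit Arguments.
Unset Strict Implicit.
Unset Printing Implicit Defensive.

Import Order.TTheory GRing.Theory Num.Theory.
Local Open Scope ring_scope.

(** * Integer polynomials with small coefficients, and their inner product *)

(** The constant coefficient is a multiple of [B] of absolute value below [B], hence zero; divide by
    ['X] and repeat. This lifts an integer identity in base [B] to digit polynomials. *)
Lemma small_coef_root (B : int) (Q : {poly int}) :
  (forall k, `|Q`_k| < B) -> Q.[B] = 0 -> Q = 0.
Proof.
elim/poly_ind: Q => // p c IH small; rewrite hornerMXaddC => pB0.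
have B0 : 0 < B := le_lt_trans (normr_ge0 _) (small 0%N).
have c_small : `|c| < B by have := small 0%N; rewrite coefD coefMX coefC add0r.
have c0 : c = 0.
  have cE : c = - p.[B] * B.
    by move/eqP: pB0; rewrite addrC addr_eq0 mulNr => /eqP.
  have [pB|pB] := eqVneq p.[B] 0; first by rewrite cE pB oppr0 mul0r.
  by move: c_small; rewrite cE normrM normrN (gtr0_norm B0); nia.
rewrite c0 polyC0 addr0 IH ?mul0r //.
  by move=> k; have := small k.+1; rewrite coefD coefMX coefC addr0.
by move/eqP: pB0; rewrite c0 addr0 mulf_eq0 (gt_eqF B0) orbF => /eqP.
Qed.

(** By Parseval, the L^2 inner product on the unit circle for polynomials of size at most [n]. *)
Definition coef_dot (n : nat) (p q : {poly int}) : int :=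
  \sum_(k < n) p`_k * q`_k.

Lemma coef_dot_sqrB n (p q : {poly int}) :
  coef_dot n (p - q) (p - q) =
  coef_dot n p p - 2 * coef_dot n p q + coef_dot n q q.
Proof.
rewrite /coef_dot mulr_sumr -sumrB -big_split /=.
by apply: eq_bigr => k _; rewrite coefB; ring.
Qed.

Lemma coef_dot_ge0 n (p : {poly int}) : 0 <= coef_dot n p p.
Proof. by apply: sumr_ge0 => k _; rewrite -expr2 sqr_ge0. Qed.

Lemma coef_dot_eq0 n (p : {poly int}) : (size p <= n)%N -> coef_dot n p p = 0 -> p = 0.
Proof.
move=> sz /eqP; rewrite psumr_eq0 => [|k _]; last by rewrite -expr2 sqr_ge0.
move=> /allP p0; apply/polyP => k; rewrite coef0.
have [kn|nk] := ltnP k n; last by rewrite nth_default // (leq_trans sz).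
by have := p0 (Ordinal kn) (mem_index_enum _); rewrite /= mulf_eq0 orbb => /eqP.
Qed.

(** For [c = 1] or [c = -1] the conjugate of [t + c] on the unit circle is [c * (t + c) / t]: the
    adjoint of multiplication by ['X + c] is the same multiplication up to the factor [c] and an
    index shift. *)
Lemma coef_dot_XaddC (c : int) (n : nat) (a y : {poly int}) :
  c * c = 1 -> (size a <= n)%N ->
  coef_dot n.+1 (('X + c%:P) * a) y =
  c * \sum_(j < n) a`_j * (('X + c%:P) * y)`_j.+1.
Proof.
move=> cc sz; rewrite /coef_dot.
under eq_bigr do rewrite mulrDl coefD coefXM coefCM mulrDl.
rewrite big_split /= big_ord_recl mul0r add0r big_ord_recr /=.
rewrite (nth_default _ sz) mulr0 mul0r addr0 -big_split mulr_sumr /=.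
apply: eq_bigr => j _; rewrite mulrDl coefD coefXM coefCM /= add0n.
by rewrite -[X in X + _]mul1r -cc; ring.
Qed.

(* On the unit circle [8 = 2 |1 + t|^2 + 2 |1 - t|^2], so dividing the relation
   by ['X] exhibits [z0] as a convex combination, frequency by frequency, of
   [z1], [z2], [z3]; points of a common sphere admit no such nontrivial one. *)
Lemma convex_relation_rigid (n : nat) (z0 z1 z2 z3 : {poly int}) (u v : int) :
  (forall z, z \in [:: z0; z1; z2; z3] -> [/\ (size z <= n)%N,
     coef_dot n.+1 (('X + 1) * z) (('X + 1) * z) = u &
     coef_dot n.+1 (('X - 1) * z) (('X - 1) * z) = v]) ->
  ('X + 1) ^+ 2 * (z1 + z2) = 8 *: ('X * z0) + 2 *: (('X - 1) ^+ 2 * z3) ->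
  z0 = z3.
Proof.
move=> Hz rel.
have [s0 u0 v0] := Hz z0 (mem_head _ _).
have [|s1 u1 v1] := Hz z1; first by rewrite !inE eqxx ?orbT.
have [|s2 u2 v2] := Hz z2; first by rewrite !inE eqxx ?orbT.
have [|s3 u3 v3] := Hz z3; first by rewrite !inE eqxx ?orbT.
have dotU y : coef_dot n.+1 (('X + 1) * z0) (('X + 1) * y) =
    \sum_(j < n) z0`_j * (('X + 1) ^+ 2 * y)`_j.+1.
  by rewrite -polyC1 coef_dot_XaddC // mul1r polyC1 expr2 -mulrA.
have dotV y : coef_dot n.+1 (('X - 1) * z0) (('X - 1) * y) =
    - \sum_(j < n) z0`_j * (('X - 1) ^+ 2 * y)`_j.+1.
  by rewrite -polyC1 -polyCN coef_dot_XaddC // mulN1r polyCN polyC1 expr2 -mulrA.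
have dotX c y : \sum_(j < n) z0`_j * (c *: ('X * y))`_j.+1 =
    c * \sum_(j < n) z0`_j * y`_j.
  rewrite mulr_sumr; apply: eq_bigr => j _.
  by rewrite coefZ coefXM /=; ring.
pose m := \sum_(j < n) z0`_j * z0`_j.
have sumUV : u + v = 4 * m.
  rewrite -u0 -v0 dotU dotV -sumrB /m -dotX; apply: eq_bigr => j _.
  by rewrite -mulrBr -coefB; congr (_ * (polyseq _)`_ _); rewrite scaler_nat; ring.
have cross : coef_dot n.+1 (('X + 1) * z0) (('X + 1) * z1)
    + coef_dot n.+1 (('X + 1) * z0) (('X + 1) * z2)
    + 2 * coef_dot n.+1 (('X - 1) * z0) (('X - 1) * z3) = 8 * m.
  rewrite !dotU dotV /m -dotX mulrN mulr_sumr -big_split -sumrB /=.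
  apply: eq_bigr => j _; rewrite -mulrDr -coefD -mulrDr rel coefD !coefZ.
  by ring.
(* The squared norms of [('X + 1) * (z0 - z1)], [('X + 1) * (z0 - z2)] and twice that of
   [('X - 1) * (z0 - z3)] add up to [4 * (u + v) - 2 * (8 * m) = 0], so each vanishes. *)
have : coef_dot n.+1 (('X - 1) * (z0 - z3)) (('X - 1) * (z0 - z3)) = 0.
  have := coef_dot_ge0 n.+1 (('X + 1) * (z0 - z1)).
  have := coef_dot_ge0 n.+1 (('X + 1) * (z0 - z2)).
  have := coef_dot_ge0 n.+1 (('X - 1) * (z0 - z3)).
  rewrite !mulrBr !coef_dot_sqrB u0 v0 u1 u2 v3.
  move: cross; do 3![set x := coef_dot _ _ _; move: x => ?]; lia.
have sz : (size (('X - 1) * (z0 - z3))%R <= n.+1)%N.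
  apply: leq_trans (size_polyMleq _ _) _; rewrite -polyC1 size_XsubC /=.
  by rewrite ltnS (leq_trans (size_polyD _ _)) // size_polyN geq_max s0.
move=> /(coef_dot_eq0 sz)/eqP.
by rewrite mulf_eq0 -polyC1 polyXsubC_eq0 /= subr_eq0 => /eqP.
Qed.

(** * Behrend-type digit sets without nontrivial solutions *)

Lemma horner_lt_expn (B : int) (n : nat) (p : {poly int}) :
  (size p <= n)%N -> (forall k, 0 <= p`_k < B) -> 0 <= p.[B] < B ^+ n.
Proof.
move=> sz small; have B0 : 0 < B.
  by have /andP[h1 h2] := small 0%N; apply: le_lt_trans h1 h2.
rewrite (horner_coef_wide _ sz); elim: n {sz} => [|n IH].
  by rewrite big_ord0 expr0.
rewrite big_ord_recr /= exprSr; have := small n.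
have : 0 < B ^+ n by rewrite exprn_gt0.
move: IH; set s := \sum_(_ < n) _; set c := p`_n; nia.
Qed.

Lemma PoszX (m n : nat) : (m ^ n)%N%:Z = m%:Z ^+ n.
Proof. by rewrite -!natz natrX. Qed.

Lemma exists_ge_mean (T : finType) (t0 : T) (F : T -> nat) :
  exists t, (\sum_t F t <= F t * #|T|)%N.
Proof.
have [t _ tmax] := arg_maxnP F (isT : xpredT t0).
exists t; rewrite mulnC -sum_nat_const; apply: leq_sum => i _; exact: tmax.
Qed.

Section DigitPoly.
Variables b J : nat.
Hypothesis b_gt0 : (0 < b)%N.

Definition digit_poly (d : 'rV['I_b]_J) : {poly int} :=
  rVpoly (map_mx (fun k : 'I_b => (k : nat)%:Z) d).

Lemma size_digit_poly d : (size (digit_poly d) <= J)%N.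
Proof. exact: size_poly. Qed.

Lemma coef_digit_poly d k : 0 <= (digit_poly d)`_k < b%:Z.
Proof.
rewrite coef_rVpoly; case: insubP => [i _ _|_]; last by rewrite lexx ltz_nat.
by rewrite mxE lez_nat ltz_nat ltn_ord.
Qed.

Lemma digit_poly_inj : injective digit_poly.
Proof.
move=> d e /(can_inj rVpolyK)/rowP de; apply/rowP => i; apply/val_inj.
by have := de i; rewrite !mxE => -[].
Qed.

(** For [c = 1] and [c = -1] these are the two squared norms that [convex_relation_rigid] requires
    to be constant. *)
Definition digit_norm (c : int) (d : 'rV['I_b]_J) : nat :=
  `|coef_dot J.+1 (('X + c%:P) * digit_poly d) (('X + c%:P) * digit_poly d)|%N.

Lemma digit_normE c d : (digit_norm c d)%:Z =
  coef_dot J.+1 (('X + c%:P) * digit_poly d) (('X + c%:P) * digit_poly d).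
Proof. by rewrite /digit_norm gez0_abs // coef_dot_ge0. Qed.

Lemma digit_norm_lt c d : `|c| <= 1 -> (digit_norm c d < (4 * b ^ 2 * J.+1).+1)%N.
Proof.
move=> c1; rewrite ltnS -lez_nat digit_normE /coef_dot.
apply: (@le_trans _ _ (\sum_(k < J.+1) (4 * b ^ 2)%N%:Z)); last first.
  by rewrite sumr_const card_ord -mulr_natr natz -PoszM.
apply: ler_sum => k _; rewrite mulrDl coefD coefXM coefCM.
have := coef_digit_poly d k; set x := _`_k.
have : 0 <= (if k == 0%N :> nat then 0 else (digit_poly d)`_(k.-1)) < b%:Z.
  by case: ifP => _; rewrite ?coef_digit_poly // lexx ltz_nat.
set y := if _ then _ else _; move: x y => x y; rewrite PoszM PoszX.
move=> /andP[y0 yb] /andP[x0 xb]; have : -1 <= c <= 1 by lia.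
move=> c1'; have : -(b%:Z * 2) <= y + c * x <= b%:Z * 2 by nia.
by move: (y + c * x) => t; nia.
Qed.

End DigitPoly.

(** Pigeonhole on the pair of norms: some fibre of [f] has at least [b ^ J / Q ^ 2] digit vectors,
    and on it [convex_relation_rigid] leaves only trivial solutions. *)
Lemma solution_free_set (b J : nat) : (0 < b)%N -> let B := (13 * b)%N in
  exists S : seq nat, [/\ uniq S, {in S, forall s, (s < B ^ J)%N},
    {in S & &, forall s0 s1 s2, {in S, forall s3,
      (8 * B * s0 + 2 * B.-1 ^ 2 * s3 = B.+1 ^ 2 * (s1 + s2))%N -> s0 = s3}} &
    (b ^ J <= size S * (4 * b ^ 2 * J.+1).+1 ^ 2)%N].
Proof.
move=> b0 B; set Q := (4 * b ^ 2 * J.+1).+1.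
pose f (d : 'rV['I_b]_J) : 'I_Q * 'I_Q :=
  (inord (digit_norm 1 d), inord (digit_norm (-1) d)).
have [c] := exists_ge_mean (ord0, ord0) (fun c => #|[set d | f d == c]|).
have -> : (\sum_c #|[set d | f d == c]| = b ^ J)%N.
  rewrite -[RHS](_ : #|{: 'rV['I_b]_J}| = _); last by rewrite card_mx card_ord mul1n.
  rewrite -sum1_card (partition_big f xpredT) //=.
  by apply: eq_bigr => i _; rewrite -sum1_card; apply: eq_bigl => d; rewrite inE.
rewrite card_prod card_ord mulnn => cardF.
pose F := [set d | f d == c].
pose val (d : 'rV['I_b]_J) : nat := `|(digit_poly d).[B%:Z]|%N.
have valE d : (val d)%:Z = (digit_poly d).[B%:Z] /\ (val d < B ^ J)%N.
  have /andP[h1 h2] : 0 <= (digit_poly d).[B%:Z] < B%:Z ^+ J.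
    apply: horner_lt_expn (size_digit_poly _) _ => k.
    by have := coef_digit_poly b0 d k; rewrite /B; lia.
  by rewrite /val; split; rewrite -?ltz_nat ?PoszX gez0_abs.
have val_inj : injective val.
  move=> d e de; apply/digit_poly_inj/eqP; rewrite -subr_eq0; apply/eqP.
  apply: (@small_coef_root B%:Z).
    move=> k; rewrite coefB; have := coef_digit_poly b0 d k.
    have := coef_digit_poly b0 e k; rewrite /B; clear.
    move: (_`_k) (_`_k) => x y; lia.
  by rewrite hornerD hornerN -!(valE _).1 de subrr.
exists [seq val d | d <- enum F]; split.
- by rewrite map_inj_uniq ?enum_uniq.
- by move=> _ /mapP[d _ ->]; exact: (valE d).2.
- move=> _ _ _ /mapP[d0 F0 ->] /mapP[d1 F1 ->] /mapP[d2 F2 ->].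
  move=> _ /mapP[d3 F3 ->] rel.
  suff : digit_poly d0 = digit_poly d3 by rewrite /val => ->.
  apply: (@convex_relation_rigid J _ (digit_poly d1) (digit_poly d2) _
            (c.1 : nat)%:Z (c.2 : nat)%:Z).
    move=> z zs; have [d dF ->] : exists2 d, d \in F & z = digit_poly d.
      move: zs; rewrite !inE; move: F0 F1 F2 F3; rewrite !mem_enum => ? ? ? ?.
      by case/or4P => /eqP ->; [exists d0|exists d1|exists d2|exists d3].
    move: dF; rewrite inE => /eqP <- /=.
    rewrite !inordK ?digit_norm_lt // !digit_normE polyCN polyC1.
    by split=> //; exact: size_digit_poly.
  apply/eqP; rewrite -subr_eq0; apply/eqP; apply: (@small_coef_root B%:Z).
    move=> k; pose sh (q : {poly int}) := 'X * q.
    have bnd (d : 'rV['I_b]_J) i : 0 <= (iter i sh (digit_poly d))`_k < b%:Z.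
      elim: i k => [|i IH] k /=; first exact: coef_digit_poly.
      by rewrite coefXM; case: eqP => // _; rewrite lexx ltz_nat.
    (* [iter i sh] multiplies by ['X^i]. The positive weights add up to 12 and so do the negative
       ones, so each coefficient is at most [12 * b] in absolute value, below [B = 13 * b]. *)
    rewrite (_ : _ - _ = iter 2 sh (digit_poly d1) + iter 1 sh (digit_poly d1) *+ 2
      + iter 0 sh (digit_poly d1) + iter 2 sh (digit_poly d2)
      + iter 1 sh (digit_poly d2) *+ 2 + iter 0 sh (digit_poly d2)
      - iter 1 sh (digit_poly d0) *+ 8 - iter 2 sh (digit_poly d3) *+ 2
      + iter 1 sh (digit_poly d3) *+ 4 - iter 0 sh (digit_poly d3) *+ 2); last first.
      by rewrite /sh /= !scaler_nat; ring.
    rewrite !(coefB, coefD, coefMn).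
    have := (bnd d1 0, bnd d1 1, bnd d1 2, bnd d2 0, bnd d2 1, bnd d2 2)%N.
    have := (bnd d0 1, bnd d3 0, bnd d3 1, bnd d3 2)%N.
    rewrite /B; clear bnd; do 10![set x := (polyseq (iter _ sh _))`_k; move: x => ?].
    by case=> [] [] [] ? ? ? ? [] [] [] [] [] ? ? ? ? ? ?; lia.
  rewrite -polyC1 -polyCN !(hornerD, hornerN, hornerZ, hornerM, horner_exp, hornerX,
    hornerC) -!(valE _).1; move: rel => /(congr1 Posz).
  rewrite /B; set x0 := val d0; set x1 := val d1; set x2 := val d2; set x3 := val d3.
  have : (13 * b).-1%:Z = 13 * b%:Z - 1 by lia.
  rewrite !(PoszD, PoszM, PoszX) => -> ; rewrite -[(13 * b).+1]addn1 PoszD PoszM.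
  by move: b%:Z x0%:Z x1%:Z x2%:Z x3%:Z; clear; lia.
- by rewrite size_map -cardE.
Qed.

(** * The pattern and its squares modulo a prime *)

Lemma natr_Fp_inj (p m n : nat) : prime p -> (m < p)%N -> (n < p)%N ->
  m%:R = n%:R :> 'F_p -> m = n.
Proof. by move=> pp mp np /(congr1 val); rewrite /= !val_Fp_nat // !modn_small. Qed.

(** Averaging over [v]: for fixed [x], [g x + v] runs once through the group, so the mean size of
    the preimage is [#|X|]. *)
Lemma exists_dense_shift (V : finZmodType) (g : V -> V) (X : {set V}) :
  exists v, (#|X| <= #|[set x | (g x + v)%R \in X]|)%N.
Proof.
have [v] := exists_ge_mean 0 (fun v => #|[set x | (g x + v)%R \in X]|).
rewrite (_ : (\sum_v _)%N = #|X| * #|V|)%N; last first.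
  under eq_bigr do rewrite -sum1_card big_mkcond /=.
  rewrite exchange_big /= -[RHS]mulnC -sum_nat_const; apply: eq_bigr => x _.
  rewrite -big_mkcond /= sum1dep_card -(card_imset _ (addrI (g x))).
  apply: eq_card => y; apply/imsetP/idP => [[u]|yX].
    by rewrite inE inE => ? ->.
  by exists (y - g x); rewrite ?inE addrC subrK.
rewrite leq_pmul2r => [le_v|]; first by exists v.
by apply/card_gt0P; exists 0.
Qed.

Definition pattern_seq (L : int) : seq int :=
  [:: 0; (L ^+ 2 + 1) ^+ 2; 4 * L ^+ 2 + 2 * L * (L ^+ 2 - 1);
      4 * L ^+ 2 - 2 * L * (L ^+ 2 - 1)].

(** Both sides have the same total weight, first moment and second moment in [y], so every quadratic
    polynomial in [y] satisfies the relation. Taking [B = l ^ 2] a square makes the two points on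
    the right integral. *)
Lemma pattern_square_relation (F : comNzRingType) (x d v l : F) :
  let z y := (x + d * y) ^+ 2 + v in
  8 * l ^+ 2 * z ((l ^+ 2 + 1) ^+ 2) + 2 * (l ^+ 2 - 1) ^+ 2 * z 0 =
  (l ^+ 2 + 1) ^+ 2 * (z (4 * l ^+ 2 + 2 * l * (l ^+ 2 - 1))
                     + z (4 * l ^+ 2 - 2 * l * (l ^+ 2 - 1))).
Proof. by move=> z; rewrite /z; ring. Qed.

Lemma map_pattern_seq (F : comNzRingType) (L : nat) :
  [seq y%:~R : F | y <- pattern_seq L%:Z] =
  [:: 0; (L%:R ^+ 2 + 1) ^+ 2; 4 * L%:R ^+ 2 + 2 * L%:R * (L%:R ^+ 2 - 1);
      4 * L%:R ^+ 2 - 2 * L%:R * (L%:R ^+ 2 - 1)].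
Proof.
by rewrite /= !(rmorph0, rmorphD, rmorphN, rmorphM, rmorphXn, rmorph1, rmorph_nat) /=.
Qed.

Lemma weighted_sum_lt (a c K x y T : nat) : (0 < K)%N -> (a + c = K)%N ->
  (x < T)%N -> (y < T)%N -> (a * x + c * y < K * T)%N.
Proof.
case: T => // T K0 acK; rewrite !ltnS => xT yT.
apply: leq_ltn_trans (_ : K * T < _)%N; last by rewrite ltn_pmul2l.
by rewrite -acK mulnDl leq_add // leq_mul2l ?xT ?yT orbT.
Qed.

Section Cells.
Variables (p L M w : nat) (S : seq nat).
Hypotheses (p_prime : prime p) (L_gt0 : (0 < L)%N) (S_uniq : uniq S).
Hypothesis S_lt : {in S, forall s, (s < M)%N}.
Let B := (L ^ 2)%N.
Let K := (2 * B.+1 ^ 2)%N.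
Hypothesis S_free : {in S & &, forall s0 s1 s2, {in S, forall s3,
  (8 * B * s0 + 2 * B.-1 ^ 2 * s3 = B.+1 ^ 2 * (s1 + s2))%N -> s0 = s3}}.
Hypothesis KKMw_le : (K * (K * w * M) <= p)%N.
Hypothesis Kp : (K < p)%N.

(** The spacing [K * w] is [K] times the interval length, where [K] is the total weight of each side
    of the relation: weighted sums of offsets below [w] never reach the next multiple of [K * w]. *)
Definition cells : {set 'F_p} :=
  [set t in [seq (s * (K * w) + r)%N%:R : 'F_p | s <- S, r <- iota 0 w]].

Let B_gt0 : (0 < B)%N. Proof. by rewrite expn_gt0 L_gt0. Qed.

Let K_gt0 : (0 < K)%N. Proof. by []. Qed.

Let KE : (8 * B + 2 * B.-1 ^ 2 = K)%N.
Proof. by rewrite /K; case: B B_gt0 => // m _ /=; ring. Qed.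

Lemma cells_lt s r : s \in S -> (r < w)%N -> (s * (K * w) + r < K * w * M)%N.
Proof.
move=> /S_lt sM rw; have : (s.+1 * (K * w) <= K * w * M)%N.
  by rewrite mulnC leq_mul2l sM orbT.
apply: leq_trans; rewrite mulSn addnC ltn_add2r.
by apply: leq_trans rw _; rewrite leq_pmull.
Qed.

Lemma leq_cells_p : (K * w * M <= p)%N.
Proof. by apply: leq_trans KKMw_le; rewrite leq_pmull. Qed.

Lemma card_cells : #|cells| = (size S * w)%N.
Proof.
rewrite cardsE; apply: etrans (_ : _ = size [seq (s * (K * w) + r)%N%:R : 'F_p
  | s <- S, r <- iota 0 w]) _; last by rewrite size_allpairs size_iota.
apply/card_uniqP/allpairs_uniq => //; first exact: iota_uniq.
move=> _ _ /allpairsP[[s r] /= [sS rw ->]] /allpairsP[[s' r'] /= [s'S r'w ->]] /=.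
move: rw r'w; rewrite !mem_iota /= add0n => rw r'w.
have w0 : (0 < w)%N by case: (w) rw.
have wK : (w <= K * w)%N by rewrite leq_pmull.
have Kw0 : (0 < K * w)%N by rewrite muln_gt0 w0.
move=> /(natr_Fp_inj p_prime) E; have {}E : (s * (K * w) + r = s' * (K * w) + r')%N.
  by apply: E; apply: leq_trans leq_cells_p; apply: cells_lt.
have /eqP := congr1 (divn^~ (K * w)%N) E.
rewrite /= !divnMDl // !divn_small ?(leq_trans rw) ?(leq_trans r'w) // !addn0.
by move=> /eqP ss; move: E; rewrite ss => /addnI ->.
Qed.

Lemma cellsP t : t \in cells ->
  exists s r, [/\ s \in S, (r < w)%N & t = (s * (K * w) + r)%N%:R].
Proof.
rewrite inE => /allpairsP[[s r] /= [sS]]; rewrite mem_iota add0n /= => rw ->.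
by exists s, r.
Qed.

(* All four cells coincide, so the difference of two of the squares, an
   injective affine function of [x], takes fewer than [2 * w] values. *)
Lemma card_pattern_cells (d v : 'F_p) : d != 0 ->
  (#|[set x : 'F_p | all (fun y : int => ((x + d * y%:~R) ^+ 2 + v)%R \in cells)
                         (pattern_seq L%:Z)]| <= 2 * w)%N.
Proof.
move=> d0; set X := [set x | _].
have K0 : K%:R != 0 :> 'F_p.
  apply/eqP => K0; have /(natr_Fp_inj p_prime) : K%:R = 0%N%:R :> 'F_p by [].
  by move=> /(_ Kp (prime_gt0 p_prime)) KK; move: K_gt0; rewrite KK.
(* This is [(x + d * (B + 1) ^ 2) ^ 2 - x ^ 2 + w]. When both squares share a cell it equals
   [r0 - r3 + w], where the shift by [w] keeps the value nonnegative. *)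
pose h (x : 'F_p) : 'F_p := (d * B.+1%:R ^+ 2) ^+ 2 + w%:R + d * K%:R * x.
have h_inj : injective h by apply: inj_comp (addrI _) _; apply: mulfI; rewrite mulf_neq0.
rewrite -(card_imset _ h_inj).
have : h @: X \subset [seq i%:R : 'F_p | i <- iota 0 (2 * w)].
  apply/fintype.subsetP => _ /imsetP[x + ->]; rewrite inE.
  rewrite -[all _ _](all_map intr (fun y => (x + d * y) ^+ 2 + v \in cells)).
  rewrite map_pattern_seq => /and5P[c3 c0 c1 c2 _].
  have rel := pattern_square_relation x d v L%:R.
  have [s0 [r0 [S0 w0 E0]]] := cellsP c0.
  have [s1 [r1 [S1 w1 E1]]] := cellsP c1.
  have [s2 [r2 [S2 w2 E2]]] := cellsP c2.
  have [s3 [r3 [S3 w3 E3]]] := cellsP c3.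
  have BE : B.+1%:R = L%:R ^+ 2 + 1 :> 'F_p by rewrite -natr1 natrX.
  have BE' : B.-1%:R = L%:R ^+ 2 - 1 :> 'F_p.
    by rewrite -[L%:R ^+ 2]natrX -/B -{2}(prednK B_gt0) -natr1 addrK.
  have ss : s0 = s3.
    apply: (S_free S0 S1 S2 S3).
    have Z0 := cells_lt S0 w0; have Z1 := cells_lt S1 w1.
    have Z2 := cells_lt S2 w2; have Z3 := cells_lt S3 w3.
    move: rel; cbv beta zeta; rewrite E0 E1 E2 E3.
    rewrite -BE -BE' -[L%:R ^+ 2]natrX -/B -!(natrX, natrM, natrD).
    have KE2 : (B.+1 ^ 2 + B.+1 ^ 2 = K)%N by rewrite addnn -mul2n.
    move=> /(natr_Fp_inj p_prime) E.
    (* Both sides are below [K * (K * w * M) <= p], so the congruence is an equality of integers;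
       division by [K * w] then removes the offsets. *)
    have {}E : (8 * B * (s0 * (K * w) + r0) + 2 * B.-1 ^ 2 * (s3 * (K * w) + r3) =
        B.+1 ^ 2 * (s1 * (K * w) + r1) + B.+1 ^ 2 * (s2 * (K * w) + r2))%N.
      rewrite -mulnDr; apply: E; apply: leq_trans KKMw_le.
        exact: weighted_sum_lt.
      by rewrite mulnDr; exact: weighted_sum_lt.
    have w_gt0 : (0 < w)%N := leq_ltn_trans (leq0n _) w0.
    have Kw_gt0 : (0 < K * w)%N by rewrite muln_gt0 w_gt0.
    have /(congr1 (divn^~ (K * w)%N)) : ((8 * B * s0 + 2 * B.-1 ^ 2 * s3) * (K * w)
          + (8 * B * r0 + 2 * B.-1 ^ 2 * r3) =
        (B.+1 ^ 2 * (s1 + s2)) * (K * w) + (B.+1 ^ 2 * r1 + B.+1 ^ 2 * r2))%N.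
      by apply: etrans (etrans _ E) _; ring.
    by rewrite !divnMDl // !divn_small ?addn0 // weighted_sum_lt.
  apply/mapP; exists (r0 + w - r3)%N.
    by rewrite mem_iota /= add0n; clear -w0 w3; lia.
  rewrite natrB ?natrD; last by apply: leq_trans (leq_addl _ _); exact: ltnW.
  move: E0 E3; rewrite ss !natrD => E0 E3.
  have -> : r0%:R = (x + d * (L%:R ^+ 2 + 1) ^+ 2) ^+ 2 + v - (s3 * (K * w))%:R :> 'F_p.
    by rewrite E0 addrC addKr.
  have -> : r3%:R = (x + d * 0) ^+ 2 + v - (s3 * (K * w))%:R :> 'F_p.
    by rewrite E3 addrC addKr.
  by rewrite /h /K natrM natrX BE; ring.
move=> /subset_leq_card /leq_trans; apply.
by apply: leq_trans (card_size _) _; rewrite size_map size_iota.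
Qed.

End Cells.

(** * From residue classes to sets of integers *)

Definition pattern (L : nat) : {fset 'rV[int]_1} :=
  [fset x in [seq const_mx y | y <- pattern_seq L%:Z]]%fset.

Lemma mem_pattern (L : nat) (y : int) :
  y \in pattern_seq L%:Z -> const_mx y \in pattern L.
Proof. by move=> yP; rewrite in_fset; apply: map_f. Qed.

Lemma card_pattern (L : nat) : (4 < L)%N -> #|` pattern L|%fset = 4%N.
Proof.
move=> L4; rewrite card_fseq undup_id ?size_map // map_inj_uniq.
  rewrite /= !inE !negb_or !andbT.
  have L5 : 5 <= L%:Z by rewrite lez_nat.
  by move: (L%:Z) L5 => l l5; do ![apply/andP; split]; apply/eqP; nia.
by move=> x y /matrixP/(_ 0 0); rewrite !mxE.
Qed.

Lemma card_le_count_Fp (p : nat) (X : {set 'F_p}) : prime p ->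
  (#|X| <= size [seq k <- iota 1 p | (k%:R : 'F_p) \in X])%N.
Proof.
move=> pp; rewrite -(size_map (fun k : nat => k%:R : 'F_p)).
apply: leq_trans (card_size _); apply/subset_leq_card/fintype.subsetP => x xX.
have xp : (val x < p)%N by have := ltn_ord x; rewrite [X in (_ < X)%N]Fp_cast.
(* The interval starts at 1, so the zero class is represented by [p]. *)
apply/mapP; have [x0|x0] := posnP (val x).
  have E : p%:R = x by rewrite pchar_Fp_0 //; apply: val_inj; rewrite /= x0.
  by exists p; rewrite ?E // mem_filter E xX mem_iota add1n ltnS leqnn prime_gt0.
by exists (val x); rewrite ?natr_Zp // mem_filter natr_Zp xX mem_iota x0 ltnW.
Qed.

(** [A] consists of the representatives in [1, ..., p] of the [x] with [x ^ 2 + v] in a cell. If [p]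
    divides [d], two pattern points would differ by a nonzero multiple of [p], which does not fit in
    the box; otherwise reduction modulo [p] is injective on [A] and [card_pattern_cells] applies. *)
Lemma dense_set_few_patterns (p L M w : nat) (S : seq nat) :
  let B := (L ^ 2)%N in let K := (2 * B.+1 ^ 2)%N in
  prime p -> (0 < L)%N -> uniq S -> {in S, forall s, (s < M)%N} ->
  {in S & &, forall s0 s1 s2, {in S, forall s3,
    (8 * B * s0 + 2 * B.-1 ^ 2 * s3 = B.+1 ^ 2 * (s1 + s2))%N -> s0 = s3}} ->
  (K * (K * w * M) <= p)%N -> (K < p)%N ->
  exists A : {fset 'rV[int]_1}, [/\ forall x, x \in A -> in_box p x,
    (size S * w <= #|` A|%fset)%N &
    forall d : int, d != 0 -> (pattern_count (pattern L) A d <= 2 * w)%N].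
Proof.
move=> B K pp L0 uS ltS freeS Kw Kp.
have [v] := exists_dense_shift (fun x => x ^+ 2) (cells p L w S).
rewrite (card_cells pp uS ltS Kw) => cardX.
set X := [set x : 'F_p | x ^+ 2 + v \in cells p L w S] in cardX.
pose I := [seq k <- iota 1 p | (k%:R : 'F_p) \in X].
pose A := [fset x in [seq const_mx k%:Z | k <- I]]%fset : {fset 'rV[int]_1}.
have const_inj : injective (fun k : nat => const_mx k%:Z : 'rV[int]_1).
  by move=> k l /matrixP/(_ 0 0); rewrite !mxE => -[].
have AP x : x \in A ->
    exists k : nat, [/\ x = const_mx k%:Z, (0 < k <= p)%N & (k%:R : 'F_p) \in X].
  rewrite inE => /mapP[k]; rewrite mem_filter mem_iota add1n ltnS => /andP[kX kp] ->.
  by exists k.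
exists A; split.
- move=> x /AP[k [-> kp _]] i; rewrite mxE !lez_nat; exact: kp.
- rewrite card_fseq undup_id ?size_map; last first.
    by rewrite map_inj_uniq // filter_uniq // iota_uniq.
  by rewrite (leq_trans cardX) // card_le_count_Fp.
move=> d d0.
have P0 : const_mx 0 \in pattern L by apply: mem_pattern; rewrite inE.
have P_neq0 : pattern L != fset0 by apply/fset0Pn; exists (const_mx 0).
have finP := finite_pattern_set P_neq0 A d.
have memA (x : 'rV[int]_1) (y : int) : x \in fset_set (pattern_set (pattern L) A d) ->
    y \in pattern_seq L%:Z -> x + d *: const_mx y \in A.
  by rewrite in_fset_set // inE => Hx /mem_pattern; apply: Hx.
have memA0 (x : 'rV[int]_1) : x \in fset_set (pattern_set (pattern L) A d) -> x \in A.
  move=> /memA/(_ (mem_head _ _)); rewrite (_ : const_mx 0 = 0) ?scaler0 ?addr0 //.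
rewrite /pattern_count; have [dp|dp] := eqVneq (d%:~R : 'F_p) 0.
  rewrite (_ : fset_set _ = fset0) ?cardfs0 //; apply/eqP/fset0Pn => -[x xP].
  have [k [xk kp _]] := AP _ (memA0 _ xP).
  have [|l [xl lp _]] := AP _ (memA _ ((L%:Z ^+ 2 + 1) ^+ 2) xP _).
    by rewrite !inE eqxx orbT.
  move/matrixP: xl => /(_ 0 0); rewrite xk !mxE.
  have /eqP := dp; rewrite -(dvdz_pcharf (pchar_Fp pp)) => /dvdzP[q dE].
  have q0 : q != 0 by apply: contraNneq d0 => q0; rewrite dE q0 mul0r.
  rewrite dE mulrAC; set u := q * _.
  have u0 : u != 0 by rewrite mulf_neq0 // expf_neq0 // gt_eqF // ltr_wpDl ?sqr_ge0.
  have {u0} [u1|u1] : u <= -1 \/ 1 <= u by move: (u) u0 => ?; lia.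
    by move: (u) u1 kp lp; clear; nia.
  by move: (u) u1 kp lp; clear; nia.
pose phi (x : 'rV[int]_1) : 'F_p := (x 0 0)%:~R.
rewrite -(size_map phi); apply: leq_trans (card_pattern_cells pp L0 ltS freeS Kw Kp v dp).
rewrite cardE; apply: uniq_leq_size.
  rewrite map_inj_in_uniq ?fset_uniq // => x x' xP x'P.
  have [k [-> kp _]] := AP _ (memA0 _ xP); have [l [-> lp _]] := AP _ (memA0 _ x'P).
  rewrite /phi !mxE -!pmulrn => kl; suff -> : k = l by [].
  (* [k] or [l] may equal [p]; the predecessors are below [p], as [natr_Fp_inj] demands. *)
  have : k.-1 = l.-1; last by lia.
  apply: (natr_Fp_inj pp); rewrite ?prednK; try lia.
  apply: (addIr 1); rewrite !natr1 !prednK //; lia.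
move=> _ /mapP[x xP ->]; rewrite mem_enum inE; apply/allP => y yP.
have [k [xk kp kX]] := AP _ (memA _ _ xP yP).
suff -> : phi x + d%:~R * y%:~R = k%:R by move: kX; rewrite inE.
move/matrixP: xk => /(_ 0 0); rewrite !mxE => /(congr1 (fun z : int => z%:~R : 'F_p)).
by rewrite rmorphD rmorphM /= -pmulrn.
Qed.

(** * Bounding the popular difference density *)

(** Boxes of large prime side [p] refute any admissible [c > 1 / M]: every nonzero [d] has at most
    [2 * w <= p / M] patterns, because [w * K ^ 2 * M <= p] and [K ^ 2 >= 2]. *)
Lemma pdd_pattern_le (R : realType) (L M : nat) (S : seq nat) (alpha : R) :
  let B := (L ^ 2)%N in let K := (2 * B.+1 ^ 2)%N in
  (0 < L)%N -> (0 < M)%N -> uniq S -> {in S, forall s, (s < M)%N} ->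
  {in S & &, forall s0 s1 s2, {in S, forall s3,
    (8 * B * s0 + 2 * B.-1 ^ 2 * s3 = B.+1 ^ 2 * (s1 + s2))%N -> s0 = s3}} ->
  alpha * (2 * K ^ 2 * M)%N%:R <= (size S)%:R ->
  pdd (pattern L) alpha <= M%:R^-1.
Proof.
move=> B K L0 M0 uS ltS freeS le_alpha.
have M0R : 0 < M%:R :> R by rewrite ltr0n.
apply: ge_sup; first by exists 0; exact: pdd_admissible0.
move=> c c_adm; rewrite leNgt; apply/negP => c_gt.
have eps0 : 0 < (c - M%:R^-1) / 2 by rewrite divr_gt0 // subr_gt0.
have [N0 HN] := c_adm _ eps0.
have [p p_gt pp] := prime_above (N0 + K ^ 2 * M + K).
(* The largest interval length that the cells allow. As [p > K ^ 2 * M], rounding down costs at most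
   a factor 2, which is the 2 in the density hypothesis. *)
pose w := (p %/ (K ^ 2 * M))%N.
have K2 : (1 < K)%N by rewrite /K leq_pmulr.
have K2M0 : (0 < K ^ 2 * M)%N by rewrite muln_gt0 M0 expn_gt0 (ltnW K2).
have wp : (w * (K ^ 2 * M) <= p)%N := leq_trunc_div _ _.
have pw : (p <= 2 * (K ^ 2 * M) * w)%N.
  have p1 : (p < w.+1 * (K ^ 2 * M))%N by rewrite ltn_ceil.
  have w1 : (0 < w)%N by rewrite divn_gt0 //; move: p_gt; clear; lia.
  by move: p1 w1; move: (K ^ 2 * M)%N => m; clear; nia.
have Kw : (K * (K * w * M) <= p)%N.
  by apply: leq_trans wp; rewrite leq_eqVlt; apply/orP; left; apply/eqP; ring.
have Kp : (K < p)%N by move: p_gt; clear; lia.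
have [A [Abox Acard Acount]] := dense_set_few_patterns pp L0 uS ltS freeS Kw Kp.
have [||d d0] := HN p _ A Abox.
- by move: p_gt; clear; lia.
- rewrite expr1; apply: (@le_trans _ _ (size S * w)%N%:R); last by rewrite ler_nat.
  have K2M0R : 0 < (2 * K ^ 2 * M)%N%:R :> R by rewrite ltr0n -mulnA muln_gt0 K2M0.
  rewrite -(ler_pM2r K2M0R) [(size S * w)%:R]natrM mulrAC.
  apply: (@le_trans _ _ ((size S)%:R * p%:R)); first by rewrite ler_wpM2r ?ler0n.
  rewrite -!mulrA ler_wpM2l ?ler0n // -natrM ler_nat.
  by apply: leq_trans pw _; rewrite leq_eqVlt; apply/orP; left; apply/eqP; ring.
apply/negP; rewrite -ltNge expr1.
apply: (@le_lt_trans _ _ (2 * w)%N%:R); first by rewrite ler_nat Acount.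
apply: (@le_lt_trans _ _ (M%:R^-1 * p%:R)).
  rewrite mulrC ler_pdivlMr // -natrM ler_nat (leq_trans _ wp) //.
  have : (2 <= K ^ 2)%N by rewrite (leq_trans K2) // -{1}[K]expn1 leq_pexp2l // ltnW.
  by move: (K ^ 2)%N => k; clear; nia.
rewrite ltr_pM2r ?ltr0n ?prime_gt0 //; lra.
Qed.

Lemma cube_le_exp2 (n : nat) : (n.+1 ^ 3 <= 27 * 2 ^ n)%N.
Proof.
(* [(n + 2) ^ 3 <= 2 * (n + 1) ^ 3] holds only from [n = 3] on. *)
elim: n => [|n IH] //; case: (leqP n 2) => [|n3]; first by case: n {IH} => [|[|[|]]].
rewrite [(2 ^ _)%N]expnS; move: (2 ^ n)%N IH => m; rewrite !expnS expn0 => IH; nia.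
Qed.

Lemma square_le_exp2 (c n : nat) : (27 * c <= n)%N -> (c * n.+1 ^ 2 <= 2 ^ n)%N.
Proof.
move=> cn; have := cube_le_exp2 n; rewrite expnS => H.
rewrite -(@leq_pmul2l 27) // (leq_trans _ H) // mulnA leq_mul2r.
by rewrite (leq_trans cn) ?orbT.
Qed.

Theorem theorem1p7 (R : realType) (C : R) (C_gt0 : 0 < C) :
  exists P : {fset 'rV[int]_1}, #|` P|%fset = 4%N /\
    exists2 alpha0 : R, 0 < alpha0 &
      forall alpha : R, 0 < alpha -> alpha < alpha0 ->
        pdd P alpha < alpha `^ C.
Proof.
pose m := Num.bound C.
have Cm : C < m%:R by apply: archi_boundP; exact: ltW.
have m_gt0 : (0 < m)%N by rewrite -(ltr0n R) (lt_trans C_gt0).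
(* Since [26 = 2 * 13], density [26 ^ - J] leaves a factor [2 ^ J] below [13 ^ - J] to absorb
   polynomial losses. [L ^ 2 >= 26 ^ (2 * m)] gives the exponent [m > C] with room to spare. *)
pose L := (13 * 26 ^ m)%N; pose b := (13 * 26 ^ (2 * m))%N.
have b_gt0 : (0 < b)%N by rewrite muln_gt0 expn_gt0.
have LE : (L ^ 2 = 13 * b)%N by rewrite /L /b [(2 * m)%N]mulnC expnM; ring.
have L13 : (13 <= L)%N by rewrite leq_pmulr // expn_gt0.
pose K := (2 * (L ^ 2).+1 ^ 2)%N.
(* The loss is [2 * K ^ 2 * (4 * b ^ 2 * (J + 1) + 1) ^ 2 <= 50 * K ^ 2 * b ^ 4 * (J + 1) ^ 2]; the
   27 comes from [square_le_exp2]. *)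
pose J0 := (27 * (50 * K ^ 2 * b ^ 4))%N.
exists (pattern L); split; first by rewrite card_pattern // (leq_trans _ L13).
have pos26 n : 0 < (26 ^ n)%N%:R :> R by rewrite ltr0n expn_gt0.
exists (26 ^ J0)%N%:R^-1 => [|alpha alpha_gt0 alpha_lt]; first by rewrite invr_gt0.
have ex_n : exists n, (26 ^ n)%N%:R^-1 < alpha.
  exists (Num.bound alpha^-1); rewrite invf_plt ?posrE //.
  apply: (@lt_trans _ _ (Num.bound alpha^-1)%:R).
    by apply: archi_boundP; rewrite invr_ge0 ltW.
  by rewrite ltr_nat ltn_expl.
(* Minimality brackets [alpha]: [26 ^ - (J + 1) < alpha <= 26 ^ - J]. *)
case: (ex_minnP ex_n) => -[|J] alpha_gt min_n.
  have := lt_trans alpha_gt alpha_lt; rewrite ltf_pV2 ?posrE // ltr_nat.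
  by rewrite ltnNge expn_gt0.
have J_ge : (J0 <= J)%N.
  rewrite -ltnS ltnNge; apply/negP => JJ0.
  have := lt_trans alpha_gt alpha_lt; rewrite ltf_pV2 ?posrE // ltr_nat.
  by rewrite ltnNge leq_exp2l ?JJ0.
have alpha_le : alpha <= (26 ^ J)%N%:R^-1.
  by rewrite leNgt; apply/negP => /min_n; rewrite ltnn.
have [S [uS ltS freeS cardS]] := solution_free_set J b_gt0.
rewrite -LE in ltS freeS.
have M_gt0 : (0 < (L ^ 2) ^ J)%N by rewrite !expn_gt0 (leq_trans _ L13).
have pdd_le : pdd (pattern L) alpha <= ((L ^ 2) ^ J)%N%:R^-1.
  apply: pdd_pattern_le uS ltS freeS _ => //; first exact: leq_trans L13.
  rewrite -/K; apply: (@le_trans _ _ ((26 ^ J)%N%:R^-1 * (2 * K ^ 2 * (L ^ 2) ^ J)%N%:R)).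
    by rewrite ler_wpM2r ?ler0n.
  rewrite mulrC ler_pdivrMr // -natrM ler_nat LE expnMn.
  have Q_le : (2 * K ^ 2 * (4 * b ^ 2 * J.+1).+1 ^ 2 <= 2 ^ J)%N.
    apply: leq_trans (square_le_exp2 J_ge).
    apply: (@leq_trans (2 * K ^ 2 * (5 * b ^ 2 * J.+1) ^ 2)%N).
      rewrite leq_mul2l leq_sqr; apply/orP; right.
      have : (0 < b ^ 2 * J.+1)%N by rewrite muln_gt0 expn_gt0 b_gt0.
      by rewrite -!mulnA; move: (b ^ 2 * J.+1)%N; clear; lia.
    by rewrite leq_eqVlt; apply/orP; left; apply/eqP; ring.
  apply: (@leq_trans (2 * K ^ 2 * (13 ^ J *
    (size S * (4 * b ^ 2 * J.+1).+1 ^ 2)))%N).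
    by rewrite !leq_mul2l cardS !orbT.
  rewrite (_ : 26 = 2 * 13)%N // expnMn [X in (_ <= X)%N]mulnC -[X in (_ <= X)%N]mulnA.
  apply: leq_trans (leq_mul Q_le (leqnn (13 ^ J * size S)%N)).
  by rewrite leq_eqVlt; apply/orP; left; apply/eqP; ring.
apply: le_lt_trans pdd_le _.
have alpha_lt1 : alpha < 1.
  by apply: lt_le_trans alpha_lt _; rewrite invf_le1 // ler1n expn_gt0.
apply: (@lt_le_trans _ _ (alpha `^ m%:R)); last first.
  by apply: ger_powR; [rewrite alpha_gt0 ltW | exact: ltW].
rewrite powR_mulrn ?ltW //.
apply: (@le_lt_trans _ _ ((26 ^ J.+1)%N%:R^-1 ^+ m)); last first.
  by rewrite ltr_pXn2r ?nnegrE ?invr_ge0 ?ler0n ?ltW // -lt0n.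
rewrite exprVn -natrX lef_pV2 ?posrE ?ltr0n ?M_gt0 ?expn_gt0 //.
rewrite ler_nat -!expnM.
have J_gt0 : (0 < J)%N by apply: leq_trans J_ge; rewrite /J0 !muln_gt0 !expn_gt0.
(* [J + 1 <= 2 * J] pays for the gap between the two bounds on [alpha]. *)
apply: (@leq_trans (26 ^ (m * (2 * J)))%N).
  rewrite leq_exp2l // mulnC leq_mul2l; apply/orP; right.
  by move: J_gt0; clear; lia.
by rewrite expnM leq_exp2r ?leq_pmull // muln_gt0 J_gt0.
Qed.
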